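(* Let $\lambda\ge0$, let $A_k\in\mathbb{R}^{m\times r}$, $B_k\in\mathbb{R}^{n\times r}$ be the sequence generated by softImpute-ALS (as defined in the context) and let $(A_*,B_* )$ denote a limit point of the sequence. Suppose that the convex problem $$\min_{M\in\mathbb{R}^{m\times n}}\ H(M):=\tfrac12\|P_\Omega(X-M)\|_F^2+\lambda\|M\|_*$$ has a minimizer with rank at most $r$. If $Z_*=A_*B_*^T$ satisfies $$Z_*\in\arg\min_{Z\in\mathbb{R}^{m\times n}}\ \tfrac12\left\|\left(P_\Omega(X)+P_\Omega^\perp(A_*B_*^T)\right)-Z\right\|_F^2+\lambda\|Z\|_*,$$ then $Z_*$ is a solution to the convex problem $\min_MH(M)$.
   Context: Let $X$ be an $m\times n$ real matrix whose entries are observed on an index set $\Omega\subseteq\{1,\dots,m\}\times\{1,\dots,n\}$. $P_\Omega(M)$ denotes the $m\times n$ matrix that agrees with $M$ on $\Omega$ and is $0$ elsewhere, and $P_\Omega^\perp(M)=M-P_\Omega(M)$. $\|M\|_*$ is the nuclear norm (sum of singular values). Fix $r\le\min(m,n)$. For $A,Z_1\in\mathbb{R}^{m\times r}$ and $B,Z_2\in\mathbb{R}^{n\times r}$ define $$Q_A(Z_1|A,B)=\tfrac12\|P_\Omega(X-Z_1B^T)+P_\Omega^\perp(AB^T-Z_1B^T)\|_F^2+\tfrac\lambda2\|Z_1\|_F^2+\tfrac\lambda2\|B\|_F^2,$$ $$Q_B(Z_2|A,B)=\tfrac12\|P_\Omega(X-AZ_2^T)+P_\Omega^\perp(AB^T-AZ_2^T)\|_F^2+\tfrac\lambda2\|A\|_F^2+\tfrac\lambda2\|Z_2\|_F^2.$$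 The softImpute-ALS iterates, from an arbitrary starting pair, satisfy $$A_{k+1}\in\arg\min_{Z_1}Q_A(Z_1|A_k,B_k),\qquad B_{k+1}\in\arg\min_{Z_2}Q_B(Z_2|A_{k+1},B_k).$$ A limit point of a sequence is the limit of some subsequence. *)

(* Defs.v *)
From HB Require Import structures.
From mathcomp Require Import all_boot all_order all_algebra.
From mathcomp Require Import polyrcf.
From mathcomp Require Import all_classical all_reals all_analysis.
Import Order.TTheory GRing.Theory Num.Theory.
Import numFieldNormedType.Exports.

Set Implicit Arguments.
Unset Strict Implicit.
Unset Printing Implicit Defensive.

Local Open Scope classical_set_scope.
Local Open Scope ring_scope.

Definition is_argmin (T : Type) (R : realType) (f : T -> R) (x : T) : Prop :=
  forall y : T, f x <= f y.

Definition is_subseq_limit (T : topologicalType) (u : nat -> T) (x : T) : Prop :=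
  exists2 phi : nat -> nat, increasing_seq phi & (u \o phi) @ \oo --> x.

Definition frobenius (R : realType) (m n : nat) (M : 'M[R]_(m, n)) : R :=
  Num.sqrt (\sum_(i < m) \sum_(j < n) M i j ^+ 2).

(* Square roots of the eigenvalues of M^T M, repeated with algebraic
   multiplicity.  The list has length n, so when m < n it carries n - m zeros
   beyond the usual min(m, n) singular values. *)
Definition singular_values (R : realType) (m n : nat) (M : 'M[R]_(m, n)) :
    seq R :=
  let p := char_poly (M^T *m M) in
  flatten [seq nseq (mup x p) (Num.sqrt x) | x <- rootsR p].

Definition nuclear_norm (R : realType) (m n : nat) (M : 'M[R]_(m, n)) : R :=
  \sum_(s <- singular_values M) s.

Section SoftImpute.
Variables (R : realType) (m n r : nat).
Variables (Omega : {set 'I_m * 'I_n}) (X : 'M[R]_(m, n)) (lambda : R).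

Definition P_Omega (M : 'M[R]_(m, n)) : 'M[R]_(m, n) :=
  \matrix_(i, j) (if (i, j) \in Omega then M i j else 0).

Definition P_Omega_perp (M : 'M[R]_(m, n)) : 'M[R]_(m, n) := M - P_Omega M.

Definition Q_A (A : 'M[R]_(m, r)) (B : 'M[R]_(n, r)) (Z1 : 'M[R]_(m, r)) : R :=
  2^-1 * frobenius (P_Omega (X - Z1 *m B^T)
                    + P_Omega_perp (A *m B^T - Z1 *m B^T)) ^+ 2
  + lambda / 2 * frobenius Z1 ^+ 2 + lambda / 2 * frobenius B ^+ 2.

Definition Q_B (A : 'M[R]_(m, r)) (B : 'M[R]_(n, r)) (Z2 : 'M[R]_(n, r)) : R :=
  2^-1 * frobenius (P_Omega (X - A *m Z2^T)
                    + P_Omega_perp (A *m B^T - A *m Z2^T)) ^+ 2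
  + lambda / 2 * frobenius A ^+ 2 + lambda / 2 * frobenius Z2 ^+ 2.

Definition softImpute_ALS (A : nat -> 'M[R]_(m, r)) (B : nat -> 'M[R]_(n, r)) :
    Prop :=
  forall k : nat,
    is_argmin (Q_A (A k) (B k)) (A k.+1) /\
    is_argmin (Q_B (A k.+1) (B k)) (B k.+1).

Definition H_objective (M : 'M[R]_(m, n)) : R :=
  2^-1 * frobenius (P_Omega (X - M)) ^+ 2 + lambda * nuclear_norm M.

Definition prox_objective (Xhat Z : 'M[R]_(m, n)) : R :=
  2^-1 * frobenius (Xhat - Z) ^+ 2 + lambda * nuclear_norm Z.

End SoftImpute.

(* Main.v *)
Require Import Defs.
From HB Require Import structures.
From mathcomp Require Import all_boot all_order all_algebra.
From mathcomp Require Import polyrcf complex ring lra.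
From mathcomp Require Import all_classical all_reals all_analysis.
Import Order.TTheory GRing.Theory Num.Theory.
Import numFieldNormedType.Exports.
Local Open Scope classical_set_scope.
Local Open Scope ring_scope.

(**
  The prox objective at Z equals H Z + |P_Omega^perp (Z0 - Z)|^2 / 2, so
  prox-optimality of Z0 says that Z0 minimises H up to a quadratic error.
  Testing it at Z0 + t (M - Z0) and using the convexity of H gives
  H Z0 - H M <= t |P_Omega^perp (Z0 - M)|^2 / 2 for 0 < t <= 1; let t -> 0.

  Convexity of the nuclear norm comes from the duality
  |M|_* = max |tr (W^H M)| over contractions W, the maximum being attained at
  the partial isometry of the polar decomposition of M.  It is proved over the
  complex numbers, where the spectral theorem for normal matrices is available.
*)

(** * A small-parameter limit and characteristic polynomials *)

Lemma le0_of_le_mul_small (R : realFieldType) (x c : R) :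
  0 <= c -> (forall t : R, 0 < t <= 1 -> x <= t * c) -> x <= 0.
Proof.
move=> c0 h; rewrite leNgt; apply/negP => x0.
have xc : 0 < x + c by rewrite ltr_wpDr.
(* For this [t] the bound becomes [x * (x + c) <= x * c], which refutes [0 < x] without a limit
   argument. *)
have := h (x / (x + c)); rewrite divr_gt0 // ler_pdivrMr // mul1r lerDl c0.
move=> /(_ isT); rewrite mulrAC ler_pdivlMr // ler_pM2l // gerDr.
by rewrite leNgt x0.
Qed.

Lemma char_poly_conjmx (F : fieldType) n (P A : 'M[F]_n) :
  P \in unitmx -> char_poly (invmx P *m A *m P) = char_poly A.
Proof.
move=> PU; pose Q := map_mx polyC P; pose Q' := map_mx polyC (invmx P).
have QQ' : Q' *m Q = 1%:M by rewrite -map_mxM mulVmx // map_mx1.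
rewrite /char_poly.
have -> : char_poly_mx (invmx P *m A *m P) = Q' *m char_poly_mx A *m Q.
  rewrite /char_poly_mx !map_mxM mulmxBr mulmxBl; congr (_ - _).
  by rewrite mul_mx_scalar -scalemxAl QQ' scalemx1.
by rewrite !det_mulmx mulrAC -det_mulmx QQ' det1 mul1r.
Qed.

(** [rootsR] lists each root once and [mup] restores its multiplicity, so any splitting of the
    characteristic polynomial, such as the one from the spectral theorem, yields the singular
    values. *)
Lemma sum_singular_values_root (R : realType) (m n : nat) (M : 'M[R]_(m, n))
    (s : seq R) :
  char_poly (M^T *m M) = \prod_(x <- s) ('X - x%:P) ->
  nuclear_norm M = \sum_(x <- s) Num.sqrt x.
Proof.
move=> ps; rewrite /nuclear_norm /singular_values ps.
set p := \prod_(x <- s) _.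
have p0 : p != 0 by rewrite /p monic_neq0 // monic_prod_XsubC.
have mupE x : mup x p = count_mem x s by exact: mu_prod_XsubC.
have rootsE : rootsR p =i s.
  move=> x; have /(_ x) := roots_on_rootsR p0.
  by rewrite in_itv /= => <-; rewrite root_prod_XsubC.
rewrite big_flatten big_map.
rewrite -[RHS](big_undup_iterop_count +%R s xpredT) /=.
have /(perm_big _) -> : perm_eq (rootsR p) (undup s).
  apply: uniq_perm; rewrite ?undup_uniq ?uniq_roots //.
  by move=> x; rewrite mem_undup rootsE.
apply: eq_bigr => x _; rewrite mupE big_nseq.
by rewrite -Monoid.iteropE.
Qed.

(** * Trace duality for the nuclear norm over the complex numbers *)

Section TraceDuality.
Local Open Scope sesquilinear_scope.
Context {C : numClosedFieldType}.

Lemma gram_diag m n (K : 'M[C]_(m, n)) i :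
  (K^t* *m K) i i = \sum_j `|K j i| ^+ 2.
Proof. by rewrite mxE; apply: eq_bigr => j _; rewrite !mxE normCKC. Qed.

(** Operator norm at most 1, tested on orthonormal bases (the columns of [U]) so that it applies
    directly in an eigenbasis of [M^t* *m M]. *)
Definition orthonormal_contraction {m n} (W : 'M[C]_(m, n)) :=
  forall U : 'M[C]_n, U \is unitarymx ->
    forall i, \sum_j `|(W *m U) j i| ^+ 2 <= 1.

Definition sv_sum {m n} (M : 'M[C]_(m, n)) : C :=
  \sum_i sqrtC (spectral_diag (M^t* *m M) 0 i).

(** The columns of [P^t*] form an orthonormal eigenbasis of [G]; hence their images under [M] are
    pairwise orthogonal, with the eigenvalues as squared lengths. *)
Lemma gram_spectral m n (M : 'M[C]_(m, n)) (G := M^t* *m M)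
    (P := spectralmx G) :
  (M *m P^t*)^t* *m (M *m P^t*) = diag_mx (spectral_diag G).
Proof.
have /orthomx_spectralP GE : G \is normalmx.
  by apply/normalmxP; rewrite /G trmx_mul map_mxM trmxCK.
have PU : P \is unitarymx := spectral_unitarymx G.
rewrite trmx_mul map_mxM trmxCK mulmxA -[X in X *m _]mulmxA -/G {1}GE.
rewrite -/P invmx_unitary // !mulmxA (unitarymxP PU) mul1mx.
by rewrite mulmxtVK.
Qed.

Lemma sum_normr_spectral m n (M : 'M[C]_(m, n)) (G := M^t* *m M) i :
  \sum_j `|(M *m (spectralmx G)^t*) j i| ^+ 2 = spectral_diag G 0 i.
Proof. by rewrite -gram_diag gram_spectral mxE eqxx. Qed.

Lemma spectral_gram_ge0 m n (M : 'M[C]_(m, n)) i :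
  0 <= spectral_diag (M^t* *m M) 0 i.
Proof. by rewrite -sum_normr_spectral sumr_ge0 // => j _; rewrite exprn_ge0. Qed.

Lemma norm_sum_conj_mul_le m (l k : 'I_m -> C) :
  \sum_j `|l j| ^+ 2 <= 1 ->
  `|\sum_j (l j)^* * k j| <= sqrtC (\sum_j `|k j| ^+ 2).
Proof.
move=> l1; pose u := \row_j k j : 'rV[C]_m; pose v := \row_j l j : 'rV[C]_m.
have dE (a b : 'I_m -> C) :
    dotmx (\row_j a j) (\row_j b j) = \sum_j (b j)^* * a j.
  by rewrite dotmxE mxE; apply: eq_bigr => j _; rewrite !mxE mulrC.
have nE (a : 'I_m -> C) : \sum_j (a j)^* * a j = \sum_j `|a j| ^+ 2.
  by apply: eq_bigr => j _; rewrite normCKC.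
have : `|dotmx u v| <= sqrtC (dotmx u u) * sqrtC (dotmx v v).
  by have [] := CauchySchwarz_sqrt (@dotmx C m) u v.
rewrite !dE !nE => /le_trans; apply.
rewrite ler_piMr ?sqrtC_ge0 ?sumr_ge0 //.
by rewrite -sqrtC1 ler_sqrtC ?nnegrE ?ler01 ?sumr_ge0 //.
Qed.

(** In the eigenbasis of [M^t* *m M], each diagonal entry pairs a column of [W *m P^t*], of length
    at most 1, with a column of [M *m P^t*], whose length is a singular value. Cauchy-Schwarz bounds
    each term. *)
Lemma norm_trace_le_sv_sum {m n} (W M : 'M[C]_(m, n)) :
  orthonormal_contraction W -> `|\tr (W^t* *m M)| <= sv_sum M.
Proof.
move=> cW; set P := spectralmx (M^t* *m M).
have PU : P \is unitarymx := spectral_unitarymx _.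
have -> : \tr (W^t* *m M) = \tr ((W *m P^t*)^t* *m (M *m P^t*)).
  rewrite trmx_mul map_mxM trmxCK [RHS]mxtrace_mulC mulmxA.
  by rewrite mulmxKtV // mxtrace_mulC.
apply: le_trans (ler_norm_sum _ _ _) _; apply: ler_sum => i _.
rewrite mxE -sum_normr_spectral -/P.
under eq_bigr do rewrite !mxE.
have := @norm_sum_conj_mul_le _ (fun j => (W *m P^t*) j i)
  (fun j => (M *m P^t*) j i).
rewrite cW ?trmxC_unitary // => /(_ isT); apply: le_trans.
by under [in leRHS]eq_bigr do rewrite !mxE.
Qed.

Lemma polar_contraction {m n} (M : 'M[C]_(m, n)) :
  exists2 W : 'M[C]_(m, n),
    orthonormal_contraction W & \tr (W^t* *m M) = sv_sum M.
Proof.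
set G := M^t* *m M; set P := spectralmx G; set d := spectral_diag G.
have PU : P \is unitarymx := spectral_unitarymx _.
have d0 i : 0 <= d 0 i by exact: spectral_gram_ge0.
set K := M *m P^t*.
have KK : K^t* *m K = diag_mx d by exact: gram_spectral.
(* Since the inverse of 0 is 0, [S] is the pseudo-inverse of the square root of [diag_mx d]. *)
pose S := diag_mx (\row_i (sqrtC (d 0 i))^-1).
have St : S^t* = S.
  rewrite /S tr_diag_mx map_diag_mx; congr diag_mx; apply/rowP => i.
  by rewrite !mxE /= geC0_conj // invr_ge0 sqrtC_ge0.
have SKK i j : (S *m (K^t* *m K)) i j = sqrtC (d 0 i) *+ (i == j).
  rewrite KK mulmx_diag !mxE; congr (_ *+ _).
  have [->|nz] := eqVneq (sqrtC (d 0 i)) 0; first by rewrite invr0 mul0r.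
  by rewrite -[X in _ * X]sqrtCK expr2 mulKf.
(* This is [M] times the pseudo-inverse of the square root of [G], the partial isometry of the polar
   decomposition. *)
exists (K *m S *m P).
  move=> U UU i; rewrite -gram_diag.
  set V := P *m U.
  have VU : V^t* \is unitarymx by rewrite trmxC_unitary mul_unitarymx.
  have -> : (K *m S *m P *m U)^t* *m (K *m S *m P *m U) =
    V^t* *m ((S *m (K^t* *m K)) *m S) *m V.
    by rewrite -!(mulmxA (K *m S)) -/V !(trmx_mul, map_mxM) St !mulmxA.
  (* A 0/1 diagonal is a projection: it only drops nonnegative terms from the unit squared length of
     a column of [V]. *)
  have -> : S *m (K^t* *m K) *m S = diag_mx (\row_i (d 0 i != 0)%:R).
    apply/matrixP => a b; rewrite {2}/S mul_mx_diag mxE SKK !mxE.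
    have [->|_] := eqVneq a b; last by rewrite !mulr0n mul0r.
    rewrite !mulr1n -(sqrtC_eq0 (d 0 b)).
    have [->|nz] := eqVneq (sqrtC (d 0 b)) 0; first by rewrite mul0r.
    by rewrite mulfV.
  have /unitarymxP/matrixP/(_ i i) := VU; rewrite trmxCK mxE [RHS]mxE eqxx => V1.
  rewrite mul_mx_diag mxE -[leRHS]V1; apply: ler_sum => k _.
  rewrite !mxE mulrAC /= -normCKC.
  by case: (_ != 0); rewrite ?mulr1 ?mulr0 // exprn_ge0.
have -> : \tr ((K *m S *m P)^t* *m M) = \tr (S *m (K^t* *m K)).
  by rewrite !trmx_mul !map_mxM St -mulmxA mxtrace_mulC -!mulmxA.
by apply: eq_bigr => i _; rewrite SKK eqxx.
Qed.

(** A [W] attaining the maximum for the combination is also admissible for [M] and for [N], and the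
    trace is linear. *)
Lemma sv_sum_sublinear m n (a b : C) (M N : 'M[C]_(m, n)) :
  0 <= a -> 0 <= b -> sv_sum (a *: M + b *: N) <= a * sv_sum M + b * sv_sum N.
Proof.
move=> a0 b0; have [W cW E] := polar_contraction (a *: M + b *: N).
have sv_ge0 : 0 <= sv_sum (a *: M + b *: N).
  by apply: sumr_ge0 => i _; rewrite sqrtC_ge0 spectral_gram_ge0.
rewrite -(ger0_norm sv_ge0) -E mulmxDr -!scalemxAr mxtraceD !mxtraceZ.
rewrite (le_trans (ler_normD _ _)) // !normrM (ger0_norm a0) (ger0_norm b0).
by apply: lerD; apply: ler_wpM2l => //; exact: norm_trace_le_sv_sum.
Qed.

End TraceDuality.

(** * Descent from complex to real matrices *)

Section RealNuclearNorm.
Local Open Scope sesquilinear_scope.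
Variable R : realType.
Local Notation toC := (real_complex R).

Lemma sqrtC_real_complex (x : R) : 0 <= x -> sqrtC (toC x) = toC (Num.sqrt x).
Proof.
move=> x0; rewrite -{1}(sqr_sqrtr x0) rmorphXn sqrCK //.
by rewrite ler0c sqrtr_ge0.
Qed.

Lemma nuclear_norm_sv_sum m n (M : 'M[R]_(m, n)) :
  toC (nuclear_norm M) = sv_sum (map_mx toC M).
Proof.
set Mc := map_mx toC M; set d := spectral_diag (Mc^t* *m Mc).
have GE : Mc^t* *m Mc = map_mx toC (M^T *m M).
  rewrite map_mxM; congr (_ *m _).
  by apply/matrixP => i j; rewrite !mxE; exact: conjc_real.
have d0 i : 0 <= d 0 i by exact: spectral_gram_ge0.
have dR i : toC (complex.Re (d 0 i)) = d 0 i by rewrite RRe_real // ger0_real.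
have Re0 i : 0 <= complex.Re (d 0 i) by rewrite -ler0c dR.
rewrite (@sum_singular_values_root _ _ _ _ [seq complex.Re (d 0 i) | i : 'I_n]).
  rewrite big_map big_enum rmorph_sum; apply: eq_bigr => i _.
  by rewrite -[in RHS]dR sqrtC_real_complex.
(* The factorization into real roots is checked over the complex numbers, where the Gram matrix is
   diagonalized, and pulled back along the injective embedding. *)
apply: (map_poly_inj toC); rewrite map_char_poly -GE.
have /orthomx_spectralP -> : Mc^t* *m Mc \is normalmx.
  by apply/normalmxP; rewrite trmx_mul map_mxM trmxCK.
rewrite char_poly_conjmx ?spectral_unit // -/d.
rewrite char_poly_trig ?diag_mx_is_trig // rmorph_prod big_map big_enum.
apply: eq_bigr => i _.
by rewrite /= map_polyXsubC mxE eqxx mulr1n; congr ('X - _%:P); exact/esym/dR.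
Qed.

Lemma nuclear_norm_sublinear m n (a b : R) (M N : 'M[R]_(m, n)) :
  0 <= a -> 0 <= b ->
  nuclear_norm (a *: M + b *: N) <= a * nuclear_norm M + b * nuclear_norm N.
Proof.
rewrite -!ler0c => a0 b0.
have := sv_sum_sublinear m n (toC a) (toC b) (map_mx toC M) (map_mx toC N) a0 b0.
by rewrite -!map_mxZ -map_mxD -!nuclear_norm_sv_sum -!rmorphM -rmorphD lecR.
Qed.

End RealNuclearNorm.

(** * Convexity of the objective and the proximal fixed point *)

Section Objectives.
Variable (R : realType).

Lemma sqr_frobenius m n (M : 'M[R]_(m, n)) :
  frobenius M ^+ 2 = \sum_i \sum_j M i j ^+ 2.
Proof.
by rewrite sqr_sqrtr // sumr_ge0 // => i _; rewrite sumr_ge0 // => j _; rewrite sqr_ge0.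
Qed.

Lemma sqr_frobeniusZ m n a (M : 'M[R]_(m, n)) :
  frobenius (a *: M) ^+ 2 = a ^+ 2 * frobenius M ^+ 2.
Proof.
rewrite !sqr_frobenius mulr_sumr; apply: eq_bigr => i _.
by rewrite mulr_sumr; apply: eq_bigr => j _; rewrite mxE exprMn.
Qed.

Variables (m n : nat) (Omega : {set 'I_m * 'I_n}) (X : 'M[R]_(m, n)).
Variable lambda : R.
Local Notation H := (H_objective Omega X lambda).

(** The two residuals are supported on [Omega] and on its complement, so their squares add
    entrywise. *)
Lemma prox_objective_split (Z M : 'M[R]_(m, n)) :
  prox_objective lambda (P_Omega Omega X + P_Omega_perp Omega Z) M =
  H M + 2^-1 * frobenius (P_Omega_perp Omega (Z - M)) ^+ 2.
Proof.
rewrite /prox_objective /H_objective [RHS]addrAC -mulrDr; congr (_ * _ + _).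
rewrite !sqr_frobenius -big_split; apply: eq_bigr => i _.
rewrite -big_split; apply: eq_bigr => j _; rewrite !mxE /=.
by case: ifP => _; ring.
Qed.

Lemma H_objective_convex (t : R) (Z M : 'M[R]_(m, n)) :
  0 <= lambda -> 0 <= t <= 1 ->
  H ((1 - t) *: Z + t *: M) <= (1 - t) * H Z + t * H M.
Proof.
move=> l0 /andP[t0 t1]; have t1' : 0 <= 1 - t by rewrite subr_ge0.
have := nuclear_norm_sublinear _ _ _ _ _ Z M t1' t0.
move=> /(ler_wpM2l l0).
suff : frobenius (P_Omega Omega (X - ((1 - t) *: Z + t *: M))) ^+ 2 <=
   (1 - t) * frobenius (P_Omega Omega (X - Z)) ^+ 2 +
   t * frobenius (P_Omega Omega (X - M)) ^+ 2.
  by rewrite /H_objective; lra.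
rewrite !sqr_frobenius !mulr_sumr -big_split; apply: ler_sum => i _.
rewrite !mulr_sumr -big_split; apply: ler_sum => j _; rewrite !mxE /=.
case: ifP => _; last by rewrite expr0n /= !mulr0 addr0.
rewrite -subr_ge0.
set e := (X in 0 <= X).
(* The exact convexity gap of the square function. *)
have -> : e = t * (1 - t) * (Z i j - M i j) ^+ 2 by rewrite /e; ring.
by rewrite mulr_ge0 ?sqr_ge0 // mulr_ge0.
Qed.

Lemma prox_fixed_point_argmin (Z : 'M[R]_(m, n)) :
  0 <= lambda ->
  is_argmin (prox_objective lambda (P_Omega Omega X + P_Omega_perp Omega Z)) Z ->
  is_argmin H Z.
Proof.
move=> l0 hZ M; rewrite -subr_le0.
pose c := 2^-1 * frobenius (P_Omega_perp Omega (Z - M)) ^+ 2.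
apply: (@le0_of_le_mul_small _ _ c); first by rewrite mulr_ge0 ?sqr_ge0 // invr_ge0.
move=> t /andP[t0 t1]; set Zt := (1 - t) *: Z + t *: M.
(* The error thus scales as [t ^+ 2], against a change of order [t] in [H]. *)
have ZtE : P_Omega_perp Omega (Z - Zt) = t *: P_Omega_perp Omega (Z - M).
  by apply/matrixP => i j; rewrite !mxE; case: ifP => _; ring.
have Z0 : P_Omega_perp Omega (Z - Z) = 0.
  by apply/matrixP => i j; rewrite subrr !mxE; case: ifP; rewrite subrr.
have hc : H Zt <= (1 - t) * H Z + t * H M.
  by apply: H_objective_convex => //; rewrite ltW.
have := hZ Zt; rewrite !prox_objective_split ZtE Z0 sqr_frobeniusZ.
(* Writing the zero matrix as [0 *: 0] lets the scaling rule evaluate its norm. *)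
rewrite -[in X in X <= _](scale0r 0) sqr_frobeniusZ expr0n mul0r mulr0 addr0.
rewrite mulrCA -/c => hp.
(* Together [hp] and [hc] give [t * (H Z - H M) <= t * (t * c)], and the factor [t > 0] cancels. *)
by rewrite -(ler_pM2l t0); move: hc hp; lra.
Qed.

End Objectives.

Theorem theorem6 (R : realType) (m n r : nat) (hr : (r <= minn m n)%N)
  (Omega : {set 'I_m * 'I_n}) (X : 'M[R]_(m, n))
  (lambda : R) (hlambda : 0 <= lambda)
  (A : nat -> 'M[R]_(m, r)) (B : nat -> 'M[R]_(n, r))
  (hAB : softImpute_ALS Omega X lambda A B)
  (Astar : 'M[R]_(m, r)) (Bstar : 'M[R]_(n, r))
  (hlim : is_subseq_limit (fun k => (A k, B k)) (Astar, Bstar))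
  (hrank : exists M : 'M[R]_(m, n),
     is_argmin (H_objective Omega X lambda) M /\ (\rank M <= r)%N)
  (hprox : is_argmin
     (prox_objective lambda
        (P_Omega Omega X + P_Omega_perp Omega (Astar *m Bstar^T)))
     (Astar *m Bstar^T)) :
  is_argmin (H_objective Omega X lambda) (Astar *m Bstar^T).
Proof. exact: prox_fixed_point_argmin hprox. Qed.
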